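(* Let $(W,S)$ be a Coxeter system and let $\mathscr I$ be a $W$-graph ideal with respect to $J\subseteq S$, with associated $\mathcal H$-module $\mathscr S$, basis $(b_w\mid w\in\mathscr I)$ and semilinear involution $\alpha\mapsto\overline\alpha$. Let $(c_w\mid w\in\mathscr I)$ be the unique $\mathcal A$-basis of $\mathscr S$ such that for all $w\in\mathscr I$ we have $\overline{c_w}=c_w$ and $b_w=c_w+q\sum_{y\in\mathscr I,\,y<w}q_{y,w}c_y$ for certain $q_{y,w}\in\mathcal A^+$, and let $\mu_{y,w}$ be the constant term of $q_{y,w}$. Suppose that $s\in S$ and $w,y\in\mathscr I$ satisfy $w<sw\in\mathscr I$ and $y<sw$. If $y=w$ then $q_{y,sw}=1$, and if $y\ne w$ we have: (i) $q_{y,sw}=q\,q_{y,w}$ if $s\in\mathrm A_J(y)$; (ii) $q_{y,sw}=-q^{-1}(q_{y,w}-\mu_{y,w})+q_{sy,w}+\sum_x\mu_{y,x}q_{x,w}$ if $s\in\mathrm{SD}(y)$; (iii) $q_{y,sw}=-q^{-1}(q_{y,w}-\mu_{y,w})+\sum_x\mu_{y,x}q_{x,w}$ if $s\in\mathrm{WD}_J(y)$; where $q_{y,w}$ and $\mu_{y,w}$ are regarded as $0$ if $y\not<w$, and in (ii) and (iii) the sums extend over all $x\in\mathscr I$ such that $y<x<w$ and $s\notin\mathrm D_J(x)$.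
   Context: Let $(W,S)$ be a Coxeter system with length function $l$. The Bruhat order $\le$ on $W$ is the transitive closure of the relation $u\to w$ that holds if $l(u)\le l(w)$ and $w=tu$ with $t=1$ or $t$ a conjugate of an element of $S$; the symbols $<,\le$ always refer to it. The left weak order is: $u\le_L w$ if and only if $l(wu^{-1})=l(w)-l(u)$; then $u$ is called a suffix of $w$. $\mathcal A=\mathbb Z[q,q^{-1}]$ and $\mathcal A^+=\mathbb Z[q]$. The Hecke algebra $\mathcal H=\mathcal H(W)$ is the associative $\mathcal A$-algebra generated by $\{T_s\mid s\in S\}$ subject to $T_s^2=1+(q-q^{-1})T_s$ and $T_sT_{s'}T_s\cdots=T_{s'}T_sT_{s'}\cdots$ ($m(s,s')$ factors on each side, $m(s,s')$ the order of $ss'$). The involution $a\mapsto\overline a$ of $\mathcal A$ with $\overline q=q^{-1}$ extends to an involution of $\mathcal H$ with $\overline{T_s}=T_s^{-1}=T_s-(q-q^{-1})$. For $J\subseteq S$ let $D_J=\{w\in W\mid l(ws)>l(w)\text{ for all }s\in J\}$. Let $\mathscr I$ be an ideal of $(W,\le_L)$ (every suffix of an element of $\mathscr I$ lies in $\mathscr I$) and let $J\subseteq S$ satisfy $\mathscr I\subseteq D_J$. For $w\in\mathscr I$ put $\mathrm{SA}(w)=\{s\in S\mid sw>w,\ sw\in\mathscr I\}$, $\mathrm{SD}(w)=\{s\in S\mid sw<w\}$, $\mathrm{WA}_J(w)=\{s\in S\mid sw>w,\ sw\in D_J\setminus\mathscr I\}$, $\mathrm{WD}_J(w)=\{s\in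 S\mid sw>w,\ sw\notin D_J\}$, $\mathrm D_J(w)=\mathrm{SD}(w)\cup\mathrm{WD}_J(w)$ and $\mathrm A_J(w)=\mathrm{SA}(w)\cup\mathrm{WA}_J(w)$. $\mathscr I$ is a $W$-graph ideal with respect to $J$ if: (i) there is an $\mathcal A$-free $\mathcal H$-module $\mathscr S=\mathscr S(\mathscr I,J)$ with an $\mathcal A$-basis $(b_w\mid w\in\mathscr I)$ such that $T_sb_w=b_{sw}$ if $s\in\mathrm{SA}(w)$; $T_sb_w=b_{sw}+(q-q^{-1})b_w$ if $s\in\mathrm{SD}(w)$; $T_sb_w=-q^{-1}b_w$ if $s\in\mathrm{WD}_J(w)$; and $T_sb_w=qb_w-\sum_{y\in\mathscr I,\,y<sw}r^s_{y,w}b_y$ if $s\in\mathrm{WA}_J(w)$, for some polynomials $r^s_{y,w}\in q\mathcal A^+$; (ii) $\mathscr S$ admits an $\mathcal A$-semilinear involution $\alpha\mapsto\overline\alpha$ with $\overline{b_1}=b_1$ and $\overline{h\alpha}=\overline h\,\overline\alpha$ for all $h\in\mathcal H$, $\alpha\in\mathscr S$. (In particular $1\in\mathscr I$.) It is a fact that the basis $(c_w)$ in the claim exists and is unique. *)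

(* Defs.v *)
From Stdlib Require Relation_Operators.
From HB Require Import structures.
From mathcomp Require Import all_boot all_order all_algebra fraction.
From mathcomp Require Import boolp classical_sets cardinality fsbigop.

Set Implicit Arguments.
Unset Strict Implicit.
Unset Printing Implicit Defensive.

Import GRing.Theory.
Local Open Scope classical_set_scope.
Local Open Scope ring_scope.

(** ** The ring Z[q, q^-1] *)

(* Z[q, q^-1] is the subring of the fraction field of Z[q] whose elements
   are the fractions p / q^n.  Z[q] itself is {poly int}. *)
Definition is_laurent : {pred {fraction {poly int}}} := fun x =>
  `[< exists n p, x * FracField.tofrac 'X ^+ n = FracField.tofrac p >].

Lemma is_laurentP x : reflect
  (exists n p, x * FracField.tofrac 'X ^+ n = FracField.tofrac p)
  (x \in is_laurent).
Proof. exact: asboolP. Qed.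

Lemma is_laurent_subring : subring_closed is_laurent.
Proof.
split.
- by apply/is_laurentP; exists 0%N, 1; rewrite expr0 mulr1 tofrac1.
- move=> x y /is_laurentP[n [p hp]] /is_laurentP[m [r hr]].
  apply/is_laurentP; exists (n + m)%N, (p * 'X^m - r * 'X^n).
  by rewrite tofracB !tofracM !tofracXn -hp -hr exprD mulrBl -!mulrA
     [in X in _ - _ * X]mulrC.
- move=> x y /is_laurentP[n [p hp]] /is_laurentP[m [r hr]].
  apply/is_laurentP; exists (n + m)%N, (p * r).
  by rewrite tofracM -hp -hr exprD mulrACA.
Qed.

HB.instance Definition _ :=
  GRing.isSubringClosed.Build _ is_laurent is_laurent_subring.

Record laurent := Laurent {
  laurent_val : {fraction {poly int}};
  _ : laurent_val \in is_laurent }.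

HB.instance Definition _ := [isSub for laurent_val].
HB.instance Definition _ := [Choice of laurent by <:].
HB.instance Definition _ := [SubChoice_isSubComNzRing of laurent by <:].

Fact polyL_subproof (p : {poly int}) : FracField.tofrac p \in is_laurent.
Proof. by apply/is_laurentP; exists 0%N, p; rewrite expr0 mulr1. Qed.

(* The inclusion of Z[q] in Z[q, q^-1]. *)
Definition polyL (p : {poly int}) : laurent := Laurent (polyL_subproof p).

Fact polyL_zmod_morphism : zmod_morphism polyL.
Proof. by move=> p r; apply: val_inj; rewrite /= tofracB. Qed.

Fact polyL_monoid_morphism : monoid_morphism polyL.
Proof.
split=> [|p r]; apply: val_inj => /=; first exact: tofrac1.
by rewrite tofracM.
Qed.

HB.instance Definition _ :=
  GRing.isZmodMorphism.Build {poly int} laurent polyL polyL_zmod_morphism.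
HB.instance Definition _ :=
  GRing.isMonoidMorphism.Build {poly int} laurent polyL polyL_monoid_morphism.

Lemma polyL_inj : injective polyL.
Proof. by move=> p r /(congr1 val)/= /eqP; rewrite tofrac_eq => /eqP. Qed.

Fact tofracX_neq0 : FracField.tofrac ('X : {poly int}) != 0.
Proof. by rewrite tofrac_eq0 polyX_eq0. Qed.

Fact qinv_subproof : (FracField.tofrac ('X : {poly int}))^-1 \in is_laurent.
Proof.
by apply/is_laurentP; exists 1%N, 1; rewrite expr1 mulVf ?tofracX_neq0 ?tofrac1.
Qed.

Definition q : laurent := polyL 'X.
Definition qinv : laurent := Laurent qinv_subproof.

Lemma mulqV : q * qinv = 1.
Proof. by apply: val_inj; rewrite /= divff ?tofracX_neq0. Qed.

Lemma mulVq : qinv * q = 1.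
Proof. by rewrite mulrC mulqV. Qed.

Lemma laurentP (x : laurent) : exists np : nat * {poly int},
  x * q ^+ np.1 = polyL np.2.
Proof.
case/is_laurentP: (valP x) => n [p hp]; exists (n, p); apply: val_inj.
by rewrite [RHS]/= -hp /q -rmorphXn /= tofracXn.
Qed.

Definition evqinv (p : {poly int}) : laurent := (map_poly intr p).[qinv].

Fact evqinvB p r : evqinv (p - r) = evqinv p - evqinv r.
Proof. by rewrite /evqinv rmorphB hornerD hornerN. Qed.

Fact evqinvM p r : evqinv (p * r) = evqinv p * evqinv r.
Proof. by rewrite /evqinv rmorphM hornerM. Qed.

Fact evqinvXn n : evqinv 'X^n = qinv ^+ n.
Proof. by rewrite /evqinv rmorphXn /= map_polyX hornerXn. Qed.

(* The involution of Z[q, q^-1] exchanging q and q^-1: p / q^n is sent to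
   p(q^-1) q^n. *)
Definition barL (x : laurent) : laurent :=
  let np := projT1 (cid (laurentP x)) in evqinv np.2 * q ^+ np.1.

Lemma barLE x n p : x * q ^+ n = polyL p -> barL x = evqinv p * q ^+ n.
Proof.
rewrite /barL; case: cid => -[m r] /= hr hp.
have qVK k : qinv ^+ k * q ^+ k = 1 by rewrite -exprMn mulVq expr1n.
have E : r * 'X^n = p * 'X^m.
  by apply: polyL_inj; rewrite !rmorphM !rmorphXn /= -/q -hr -hp mulrAC.
have := congr1 evqinv E; rewrite !evqinvM !evqinvXn.
move/(congr1 (fun z => z * (q ^+ n * q ^+ m))).
by rewrite mulrA -(mulrA _ (qinv ^+ n)) qVK mulr1 => ->;
   rewrite (mulrC (q ^+ n)) mulrA -(mulrA _ (qinv ^+ m)) qVK mulr1.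
Qed.

Fact barL_zmod_morphism : zmod_morphism barL.
Proof.
move=> x y; case: (laurentP x) (laurentP y) => -[n p] /= hp [[m r] /= hr].
have qVK k : qinv ^+ k * q ^+ k = 1 by rewrite -exprMn mulVq expr1n.
rewrite (barLE hp) (barLE hr).
rewrite (@barLE _ (n + m) (p * 'X^m - r * 'X^n)).
  rewrite evqinvB !evqinvM !evqinvXn mulrBl; congr (_ - _).
    by rewrite exprD (mulrC (q ^+ n)) mulrA -(mulrA _ (qinv ^+ m)) qVK mulr1.
  by rewrite exprD mulrA -(mulrA _ (qinv ^+ n)) qVK mulr1.
rewrite rmorphB !rmorphM !rmorphXn /= -/q -hp -hr exprD mulrBl !mulrA.
by congr (_ - _); rewrite mulrAC.
Qed.

Fact barL_monoid_morphism : monoid_morphism barL.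
Proof.
split.
  by rewrite (@barLE 1 0 1) ?rmorph1 ?mulr1 //= /evqinv rmorph1 hornerC.
move=> x y; case: (laurentP x) (laurentP y) => -[n p] /= hp [[m r] /= hr].
rewrite (barLE hp) (barLE hr) (@barLE _ (n + m) (p * r)).
  by rewrite evqinvM exprD mulrACA.
by rewrite rmorphM /= -hp -hr exprD mulrACA.
Qed.

HB.instance Definition _ :=
  GRing.isZmodMorphism.Build laurent laurent barL barL_zmod_morphism.
HB.instance Definition _ :=
  GRing.isMonoidMorphism.Build laurent laurent barL barL_monoid_morphism.

Lemma barL_q : barL q = qinv.
Proof.
rewrite (@barLE q 0 'X) ?mulr1 //.
exact: (evqinvXn 1).
Qed.

Lemma barL_qinv : barL qinv = q.
Proof.
have := congr1 barL mulVq; rewrite rmorphM rmorph1 /= barL_q => h.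
by rewrite -[LHS]mulr1 -mulVq mulrA h mul1r.
Qed.

(** ** Coxeter systems *)

Section Coxeter.
Variables (W : groupType) (S : set W).
Implicit Types (u v w x s t : W) (ws : seq W).
Local Open Scope group_scope.

Definition is_word ws : Prop := forall s, s \in ws -> S s.

Definition wprod ws : W := foldr (fun s w => s * w) 1 ws.

Definition has_order x (m : nat) : Prop :=
  [/\ (0 < m)%N, x ^+ m = 1 & forall k, (0 < k < m)%N -> x ^+ k <> 1].

(* The congruence on words generated by (s t)^m(s,t) ~ 1, for s, t in S such
   that s t has finite order m(s,t).  Taking s = t gives the relations s^2 ~ 1,
   so no formal inverses are needed. *)
Inductive cox_equiv : seq W -> seq W -> Prop :=
| cox_refl ws : cox_equiv ws ws
| cox_sym ws1 ws2 : cox_equiv ws1 ws2 -> cox_equiv ws2 ws1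
| cox_trans ws1 ws2 ws3 :
    cox_equiv ws1 ws2 -> cox_equiv ws2 ws3 -> cox_equiv ws1 ws3
| cox_rel ws1 ws2 s t m : S s -> S t -> has_order (s * t) m ->
    cox_equiv (ws1 ++ flatten (nseq m [:: s; t]) ++ ws2) (ws1 ++ ws2).

(* S is a set of involutions generating W, and W is presented by the generators
   S and the relations (s t)^m(s,t) = 1. *)
Record coxeter_system : Prop := CoxeterSystem {
  cox_invol : forall s, S s -> has_order s 2;
  cox_gen : forall w, exists2 ws, is_word ws & wprod ws = w;
  cox_pres : forall ws1 ws2, is_word ws1 -> is_word ws2 ->
    wprod ws1 = wprod ws2 -> cox_equiv ws1 ws2 }.

Definition expressible_in w (n : nat) : Prop :=
  exists ws, [/\ is_word ws, size ws = n & wprod ws = w].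

Definition len w : nat :=
  xget 0%N [set n | expressible_in w n /\
                    forall k, expressible_in w k -> (n <= k)%N].

Definition reflection t : Prop := exists2 s, S s & exists g, t = g * s * g^-1.

Definition bruhat_step u w : Prop :=
  (len u <= len w)%N /\ exists2 t, t = 1 \/ reflection t & w = t * u.

Definition bruhat_le : W -> W -> Prop :=
  Relation_Operators.clos_trans W bruhat_step.

Definition bruhat_lt u w : Prop := bruhat_le u w /\ u <> w.

(* l(w u^-1) = l(w) - l(u), written without truncated subtraction. *)
Definition left_weak_le u w : Prop := (len (w * u^-1) + len u = len w)%N.

(* D_set J is the subset D_J of W; DJ w and AJ w below are the subsets D_J(w)
   and A_J(w) of S. *)
Definition D_set (J : set W) : set W :=
  [set w | forall s, J s -> (len w < len (w * s))%N].

Variables (I J : set W).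

Definition SA w : set W := [set s | S s /\ bruhat_lt w (s * w) /\ I (s * w)].

Definition SD w : set W := [set s | S s /\ bruhat_lt (s * w) w].

Definition WA w : set W :=
  [set s | S s /\ bruhat_lt w (s * w) /\ (D_set J `\` I) (s * w)].

Definition WD w : set W :=
  [set s | S s /\ bruhat_lt w (s * w) /\ ~ D_set J (s * w)].

Definition DJ w : set W := SD w `|` WD w.

Definition AJ w : set W := SA w `|` WA w.

End Coxeter.

(** ** The Hecke algebra *)

Section Hecke.
Variables (W : groupType) (S : set W).

Fixpoint alt_prod (R : pzSemiRingType) (a b : R) (m : nat) : R :=
  if m is n.+1 then a * alt_prod b a n else 1.

Definition hecke_relations (B : algType laurent) (f : W -> B) : Prop :=
  (forall s, S s -> f s * f s = 1 + (q - qinv) *: f s) /\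
  (forall s t m, S s -> S t -> has_order (s * t)%g m ->
     alt_prod (f s) (f t) m = alt_prod (f t) (f s) m).

(* H is the associative algebra presented by the generators T s (s in S) and
   the Hecke relations; the values of T outside S are irrelevant.  An algType is
   nonzero, but the zero algebra satisfies the universal property trivially. *)
Definition is_hecke_algebra (H : algType laurent) (T : W -> H) : Prop :=
  hecke_relations T /\
  forall (B : algType laurent) (f : W -> B), hecke_relations f ->
    exists phi : {lrmorphism H -> B},
      (forall s, S s -> phi (T s) = f s) /\
      (forall psi : {lrmorphism H -> B},
         (forall s, S s -> psi (T s) = f s) -> psi =1 phi).

Definition is_hecke_bar (H : algType laurent) (T : W -> H)
    (barH : {rmorphism H -> H}) : Prop :=
  [/\ forall a h, barH (a *: h) = barL a *: barH h,
      forall h, barH (barH h) = h &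
      forall s, S s -> barH (T s) = T s - (q - qinv)%:A].

End Hecke.

(** ** W-graph ideals *)

Section WGraphIdeal.
Variables (W : groupType) (S I J : set W).
Variables (H : algType laurent) (T : W -> H) (barH : {rmorphism H -> H}).
Variable M : lmodType H.

(* The action of Z[q, q^-1] on an H-module. *)
Definition scaleL (a : laurent) (m : M) : M := (a%:A : H) *: m.

(* (b w | w in I) is a basis of M over Z[q, q^-1]; the values of b outside I
   are irrelevant. *)
Definition is_basis (b : W -> M) : Prop :=
  (forall m, exists2 a : W -> laurent,
     finite_set [set w | I w /\ a w <> 0] &
     m = \sum_(w \in I) scaleL (a w) (b w)) /\
  (forall a : W -> laurent, finite_set [set w | I w /\ a w <> 0] ->
     \sum_(w \in I) scaleL (a w) (b w) = 0 -> forall w, I w -> a w = 0).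

(* I is a W-graph ideal with respect to J, witnessed by the H-module M, its
   basis b and its involution barM.  The summation over {y in I | y < s w} is
   a finite sum, since Bruhat intervals are finite. *)
Record W_graph_ideal (b : W -> M) (barM : M -> M) : Prop := WGraphIdeal {
  wgi_sub : J `<=` S;
  wgi_D : I `<=` D_set S J;
  wgi_ideal : forall u w, I w -> left_weak_le S u w -> I u;
  wgi_1 : I 1%g;
  wgi_basis : is_basis b;
  wgi_SA : forall w s, I w -> SA S I w s -> T s *: b w = b (s * w)%g;
  wgi_SD : forall w s, I w -> SD S w s ->
    T s *: b w = b (s * w)%g + scaleL (q - qinv) (b w);
  wgi_WD : forall w s, I w -> WD S J w s -> T s *: b w = scaleL (- qinv) (b w);
  wgi_WA : forall w s, I w -> WA S I J w s ->
    exists2 r : W -> {poly int}, forall y, exists p, r y = 'X * p &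
      T s *: b w = scaleL q (b w) -
        \sum_(y \in [set y | I y /\ bruhat_lt S y (s * w)%g])
           scaleL (polyL (r y)) (b y);
  wgi_barD : forall m n, barM (m + n) = barM m + barM n;
  wgi_barZ : forall a m, barM (scaleL a m) = scaleL (barL a) (barM m);
  wgi_barK : forall m, barM (barM m) = m;
  wgi_bar1 : barM (b 1%g) = b 1%g;
  wgi_barH : forall h m, barM (h *: m) = barH h *: barM m }.

(* c is the bar-invariant basis and Q y w is the polynomial q_{y,w}, extended
   by zero to all pairs that do not satisfy y, w in I and y < w. *)
Record canonical_basis (b : W -> M) (barM : M -> M)
    (c : W -> M) (Q : W -> W -> {poly int}) : Prop := CanonicalBasis {
  cb_basis : is_basis c;
  cb_bar : forall w, I w -> barM (c w) = c w;
  cb_dec : forall w, I w ->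
    b w = c w + scaleL q
      (\sum_(y \in [set y | I y /\ bruhat_lt S y w])
         scaleL (polyL (Q y w)) (c y));
  cb_out : forall y w, ~ [/\ I y, I w & bruhat_lt S y w] -> Q y w = 0 }.

End WGraphIdeal.

(* The constant term of q_{y,w}. *)
Definition mu (W : Type) (Q : W -> W -> {poly int}) (y w : W) : int :=
  (Q y w)`_0.

(* Main.v *)
Require Import Defs.
From mathcomp Require Import all_boot all_order all_algebra.
From mathcomp Require Import boolp classical_sets cardinality fsbigop.

Set Implicit Arguments.
Unset Strict Implicit.
Unset Printing Implicit Defensive.

Import GRing.Theory.
Local Open Scope classical_set_scope.
Local Open Scope ring_scope.

(** Write c_w for the canonical basis and b_w = c_w + q sum_(y < w) q_{y,w} c_y.
    For w < sw in I the defining property of a W-graph ideal says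
    T_s b_w = b_{sw}.  If the action of T_s on the canonical basis is known,
    then expanding both sides in the basis (c_y) and comparing coefficients of
    c_y gives the recursion for q_{y,sw} ([Q_rec_ascent], [Q_rec_descent]).

    The action of T_s is that of a W-graph ([wgraph_actionP]):
    T_s c_w = - q^-1 c_w if s is a descent of w, and otherwise
      T_s c_w = q c_w + [c_{sw}, if sw is in I] + sum mu_{y,w} c_y,
    over the y < w having s as a descent.  It is proved by induction on l(w).

    - Ascents ([action_ascent]).  T_s - q and the c's are bar-invariant, so the
      difference d of the two sides is.  Modulo q times the Z[q]-lattice
      spanned by the c's (or by the b's), induction gives d = 0.  Bar sends
      q Z[q] to q^-1 Z[q^-1], which meets it in 0, so d = 0
      ([bar_qlattice_eq0]).
    - Strong descents ([action_strong_descent]).  If sw < w, the ascent formula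
      for sw expresses c_w as (T_s - q) c_{sw} minus vectors killed by
      T_s + q^-1 by induction; and (T_s + q^-1)(T_s - q) = 0.
    - Weak descents ([action_weak_descent]).  Here T_s b_w = - q^-1 b_w.  For
      an ascent s of z the coefficient of c_z in (T_s + q^-1) b_w = 0 expresses
      the one in (T_s + q^-1) c_w as - (1 + q^2) q_{z,w}.  The latter vector is
      bar-invariant, so (1 + q^2) q_{z,w} is a constant and q_{z,w} = 0
      ([descent_Q0]).  Thus only the c_y killed by T_s + q^-1 occur in
      b_w - c_w.

    From the theory of Coxeter groups one needs that Bruhat intervals are
    finite, without which the sums over y < w carry no information, that w and
    sw are always comparable, and that u < w implies l(u) < l(w).  All three
    follow from the strong exchange condition ([strong_exchange]), which is
    deduced from the presentation: the number of times modulo 2 that a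
    reflection occurs among the reflections s_1 ... s_i ... s_1 attached to a
    word is the same for all words representing an element. *)

(** * The strong exchange condition and Bruhat intervals *)

Section Words.
Variables (W : groupType) (S : set W).
Hypothesis hW : coxeter_system S.
Implicit Types (ws : seq W) (g s t u v w : W).
Local Open Scope group_scope.

Lemma gen_mulss s : S s -> s * s = 1.
Proof. by move=> /(cox_invol hW)[_ + _]; rewrite expg2. Qed.

Lemma gen_invg s : S s -> s^-1 = s.
Proof. by move=> /gen_mulss /mulg1_eq. Qed.

Lemma gen_neq1 s : S s -> s <> 1.
Proof. by move=> /(cox_invol hW)[_ _ /(_ 1%N isT)]; rewrite expg1. Qed.

Lemma gen_mulK s w : S s -> s * (s * w) = w.
Proof. by move=> Ss; rewrite mulgA gen_mulss // mul1g. Qed.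

Lemma is_word_cat ws1 ws2 :
  is_word S ws1 -> is_word S ws2 -> is_word S (ws1 ++ ws2).
Proof. by move=> h1 h2 x; rewrite mem_cat => /orP[/h1|/h2]. Qed.

Lemma is_word_rev ws : is_word S ws -> is_word S (rev ws).
Proof. by move=> h x; rewrite mem_rev => /h. Qed.

Lemma is_word_cons s ws : S s -> is_word S ws -> is_word S (s :: ws).
Proof. by move=> Ss h x; rewrite inE => /orP[/eqP->|/h]. Qed.

Lemma is_word_subseq ws1 ws2 : subseq ws1 ws2 -> is_word S ws2 -> is_word S ws1.
Proof. by move=> /mem_subseq h12 h x /h12 /h. Qed.

Lemma wprod_cat ws1 ws2 : wprod (ws1 ++ ws2) = wprod ws1 * wprod ws2.
Proof. by elim: ws1 => [|x l IH]/=; rewrite ?mul1g // IH mulgA. Qed.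

Lemma wprod_rev ws : is_word S ws -> wprod (rev ws) = (wprod ws)^-1.
Proof.
elim: ws => [|x l IH] h /=; first by rewrite invg1.
rewrite rev_cons -cats1 wprod_cat IH => [|y yl]; last by apply: h; rewrite inE yl orbT.
by rewrite /= mulg1 invgM (gen_invg (h x _)) // inE eqxx.
Qed.

(** The reflections s_1 ... s_{i-1} s_i s_{i-1} ... s_1.  Those occurring an odd
    number of times are the t with l(tw) < l(w), w being the product. *)
Fixpoint word_refls ws : seq W :=
  if ws is s :: r then s :: [seq t ^ s^-1 | t <- word_refls r] else [::].

Definition inv_parity ws t : bool := odd (count_mem t (word_refls ws)).

Lemma word_refls_cat ws1 ws2 :
  word_refls (ws1 ++ ws2) =
  word_refls ws1 ++ [seq t ^ (wprod ws1)^-1 | t <- word_refls ws2].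
Proof.
elim: ws1 => [|s r IH] /=.
  by rewrite invg1 map_id_in // => t _; rewrite conjg1.
rewrite IH map_cat -map_comp; congr (_ :: _ ++ _); apply: eq_map => t /=.
by rewrite -conjgM invgM.
Qed.

Lemma count_map_conjg t g (l : seq W) :
  count_mem t [seq x ^ g^-1 | x <- l] = count_mem (t ^ g) l.
Proof.
rewrite count_map; apply: eq_count => x /=.
by apply/eqP/eqP => [<-|->]; rewrite -conjgM ?mulVg ?mulgV conjg1.
Qed.

Lemma inv_parity_cat ws1 ws2 t :
  inv_parity (ws1 ++ ws2) t =
  inv_parity ws1 t (+) inv_parity ws2 (t ^ wprod ws1).
Proof.
by rewrite /inv_parity word_refls_cat count_cat oddD count_map_conjg.
Qed.

Lemma inv_parity_cons s r t :
  inv_parity (s :: r) t = (s == t) (+) inv_parity r (t ^ s).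
Proof.
by rewrite /inv_parity /= oddD count_map_conjg oddb.
Qed.

Lemma wprod_relator s t m : wprod (flatten (nseq m [:: s; t])) = (s * t) ^+ m.
Proof.
elim: m => [|m IH] //; rewrite expgS -IH /= mulgA //.
Qed.

(** The reflections of the word (s t)^m are the (s t)^i s with i < 2 m. *)
Lemma word_refls_relator s t m : S s -> S t ->
  word_refls (flatten (nseq m [:: s; t])) =
  [seq (s * t) ^+ i * s | i <- iota 0 m.*2].
Proof.
move=> Ss St; elim: m => [|m IH] //.
rewrite doubleS /= mul1g IH expg1 !conjgE invgK (gen_invg Ss); congr [:: _, _ & _].
  by rewrite !mulgA.
rewrite (iotaDl 2 0) -!map_comp; apply: eq_map => i /=.
rewrite !conjgE !invgK (gen_invg Ss) (gen_invg St).
by rewrite add2n expgS expgSr -!mulgA.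
Qed.

(** If (s t)^m = 1, then (s t)^i s has period m in i, so every reflection
    occurs an even number of times. *)
Lemma inv_parity_relator s t m u : S s -> S t -> (s * t) ^+ m = 1 ->
  inv_parity (flatten (nseq m [:: s; t])) u = false.
Proof.
move=> Ss St st1; rewrite /inv_parity word_refls_relator // -addnn iotaD map_cat.
have -> : iota (0 + m) m = [seq (m + i)%N | i <- iota 0 m] by rewrite -iotaDl addn0.
rewrite -map_comp count_cat.
set l1 := map _ _; set l2 := map _ _; suff -> : l2 = l1 by rewrite oddD addbb.
by apply: eq_map => i /=; rewrite expgnDr st1 mul1g.
Qed.

(** A relator contributes nothing itself, and since its product is 1 it does
    not conjugate the reflections coming from the letters after it. *)
Lemma inv_parity_equiv ws1 ws2 t :
  cox_equiv S ws1 ws2 -> inv_parity ws1 t = inv_parity ws2 t.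
Proof.
elim=> [//|_ _ _ -> //|_ _ _ _ -> _ -> //|r1 r2 s s' m Ss Ss' [_ hm _]].
rewrite !inv_parity_cat wprod_relator hm conjg1.
by rewrite inv_parity_relator.
Qed.

Lemma inv_parity_wd ws1 ws2 t : is_word S ws1 -> is_word S ws2 ->
  wprod ws1 = wprod ws2 -> inv_parity ws1 t = inv_parity ws2 t.
Proof.
by move=> h1 h2 /(cox_pres hW h1 h2)/inv_parity_equiv.
Qed.

Lemma refl_deletion ws t : is_word S ws -> t \in word_refls ws ->
  exists r, [/\ subseq r ws, (size r < size ws)%N & wprod r = t * wprod ws].
Proof.
elim: ws t => [|s r IH] t h //; have Ss : S s by apply: h; rewrite inE eqxx.
rewrite /= inE => /orP[/eqP->|/mapP[t' ht' ->]].
  by exists r; rewrite gen_mulK //; split; first exact: subseq_cons.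
have [|r' [sr' szr' pr']] := IH t' _ ht'.
  by move=> x xr; apply: h; rewrite inE xr orbT.
exists (s :: r'); split=> /=; rewrite ?eqxx //.
by rewrite pr' conjgE invgK (gen_invg Ss) -!mulgA gen_mulK.
Qed.

(** In the palindrome a s a^-1 representing t, the letters of a and of a^-1
    together contribute as much as the trivial word a a^-1 does, that is
    nothing; the middle letter contributes t once. *)
Lemma refl_parity t : reflection S t ->
  exists ws, [/\ is_word S ws, wprod ws = t & inv_parity ws t].
Proof.
case=> s Ss [g ->]; have [a wa <-] := cox_gen hW g.
exists (a ++ s :: rev a); split.
- by apply: is_word_cat => //; apply: is_word_cons => //; apply: is_word_rev.
- by rewrite wprod_cat /= wprod_rev // mulgA.
have E : (wprod a * s * (wprod a)^-1) ^ wprod a = s.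
  by rewrite conjgE -!mulgA mulVg mulg1 mulKg.
rewrite inv_parity_cat E inv_parity_cons eqxx conjgE mulKg.
have : inv_parity (a ++ rev a) (wprod a * s * (wprod a)^-1) = false.
  rewrite (@inv_parity_wd _ [::]) //; last by rewrite wprod_cat wprod_rev // mulgV.
  by apply: is_word_cat => //; apply: is_word_rev.
by rewrite inv_parity_cat E; do 2!case: inv_parity.
Qed.

Lemma refl_mulss t : reflection S t -> t * t = 1.
Proof.
case=> s Ss [g ->]; rewrite -!mulgA mulKg [s * (s * _)]mulgA.
by rewrite gen_mulss // mul1g mulgV.
Qed.

Lemma lenP w : expressible_in S w (len S w) /\
  forall k, expressible_in S w k -> (len S w <= k)%N.
Proof.
suff [n hn] : exists n, expressible_in S w n /\
    forall k, expressible_in S w k -> (n <= k)%N 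
  by apply: (@xgetPex _ 0%N [set n | expressible_in S w n /\ forall k,
    expressible_in S w k -> (n <= k)%N]); exists n.
have ex : exists n, `[< expressible_in S w n >].
  have [ws h1 h2] := cox_gen hW w.
  by exists (size ws); apply/asboolP; exists ws.
by case: (ex_minnP ex) => n /asboolP hn hmin; exists n; split=> // k /asboolP/hmin.
Qed.

Lemma reduced_word w :
  exists ws, [/\ is_word S ws, size ws = len S w & wprod ws = w].
Proof. by case: (lenP w). Qed.

Lemma len_word ws : is_word S ws -> (len S (wprod ws) <= size ws)%N.
Proof. by move=> h; apply: (lenP _).2; exists ws. Qed.

Lemma inv_parity_len ws t : is_word S ws -> inv_parity ws t ->
  (len S (t * wprod ws) < len S (wprod ws))%N.
Proof.
move=> h ht; have [r [hr <- pr]] := reduced_word (wprod ws).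
have : t \in word_refls r.
  by rewrite -has_pred1 has_count odd_gt0 // -/(inv_parity r t) (inv_parity_wd t hr h).
move=> /(refl_deletion hr)[r' [sr' szr' pr']].
apply: leq_ltn_trans szr'; rewrite -pr -pr'.
by apply: len_word; apply: is_word_subseq hr.
Qed.

(** If the parity of t on w were even, then it would be odd on tw, whence
    l(w) = l(t t w) < l(tw). *)
Lemma strong_exchange ws t : is_word S ws -> reflection S t ->
  (len S (t * wprod ws) <= len S (wprod ws))%N ->
  (len S (t * wprod ws) < len S (wprod ws))%N /\
  exists2 r, subseq r ws & wprod r = t * wprod ws.
Proof.
move=> h ht hl; suff hp : inv_parity ws t.
  split; first exact: inv_parity_len.
  have : t \in word_refls ws by rewrite -has_pred1 has_count odd_gt0.
  by move=> /(refl_deletion h)[r []]; exists r.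
apply: contraLR hl => hp; rewrite -ltnNge.
have [u [hu pu pt]] := refl_parity ht.
have : inv_parity (u ++ ws) t.
  by rewrite inv_parity_cat pt pu conjgE mulKg (negPf hp).
move=> /(inv_parity_len (is_word_cat hu h)).
by rewrite wprod_cat pu mulgA refl_mulss // mul1g.
Qed.

(** Every proper step down in the Bruhat order deletes a letter of any given word. *)
Lemma bruhat_le_subword u w ws : bruhat_le S u w -> is_word S ws ->
  wprod ws = w -> (u = w \/ (len S u < len S w)%N) /\
  exists2 r, subseq r ws & wprod r = u.
Proof.
move=> huw; elim: huw ws => {u w} [u w [hl [t ht E]]|u v w _ IHuv _ IHvw] ws h pw.
  case: ht E => [->|ht] E; first by rewrite E mul1g in pw *; split; [left|exists ws].
  have E' : u = t * w by rewrite E mulgA refl_mulss // mul1g.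
  rewrite E' -pw; rewrite E' -pw in hl; have [h1 h2] := strong_exchange h ht hl.
  by split=> //; right.
have [hv [r sr pr]] := IHvw _ h pw.
have [hu [r' sr' pr']] := IHuv _ (is_word_subseq sr h) pr.
split; last by exists r' => //; apply: subseq_trans sr.
case: hu => [->//|hu]; case: hv => [<-|hv]; right=> //; exact: ltn_trans hv.
Qed.

Lemma bruhat_lt_len u w : bruhat_lt S u w -> (len S u < len S w)%N.
Proof.
case=> huw nuw; have [ws hws pw] := cox_gen hW w.
by case: (bruhat_le_subword huw hws pw).1.
Qed.

Lemma bruhat_lt_asym u w : bruhat_lt S u w -> ~ bruhat_lt S w u.
Proof.
move=> /bruhat_lt_len uw /bruhat_lt_len; rewrite ltnNge; apply/negP.
by rewrite negbK ltnW.
Qed.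

Lemma bruhat_lt_finite w : finite_set [set u | bruhat_lt S u w].
Proof.
have [ws hws pw] := cox_gen hW w.
pose f (m : (size ws).-tuple bool) := wprod (mask m ws).
apply: (@sub_finite_set _ _ (range f)); last exact/finite_image/finite_finset.
move=> u [huw _]; have [_ [r /subseqP[m /eqP sm rm] pr]] := bruhat_le_subword
  huw hws pw.
by exists (Tuple sm) => //; rewrite /f /= -rm.
Qed.

Lemma bruhat_gen s w : S s ->
  (len S w < len S (s * w))%N -> bruhat_lt S w (s * w).
Proof.
move=> Ss hl; split; last by move=> E; move: hl; rewrite -E ltnn.
constructor; split; first exact: ltnW.
by exists s => //; right; exists s => //; exists 1; rewrite invg1 mul1g mulg1.
Qed.

Lemma bruhat_gen_total s w : S s ->
  bruhat_lt S (s * w) w \/ bruhat_lt S w (s * w).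
Proof.
move=> Ss; case: (leqP (len S (s * w)) (len S w)) => hl; last by right;
  exact: bruhat_gen.
left; rewrite -[w in bruhat_lt _ _ w](gen_mulK w Ss); apply: bruhat_gen => //.
rewrite gen_mulK //.
have [ws hws pw] := cox_gen hW w; rewrite -pw in hl *.
have rs : reflection S s by exists s => //; exists 1; rewrite invg1 mul1g mulg1.
exact: (strong_exchange hws rs hl).1.
Qed.

Lemma gen_suffix s w : S s -> bruhat_lt S (s * w) w ->
  left_weak_le S (s * w) w.
Proof.
move=> Ss /bruhat_lt_len hl; rewrite /left_weak_le invgM mulVKg (gen_invg Ss).
have E : len S s = 1%N.
  apply/eqP; rewrite eqn_leq; apply/andP; split.
    rewrite -[s]mulg1 -[s * 1]/(wprod [:: s]); apply: len_word.
    by apply: is_word_cons.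
  rewrite lt0n; apply/eqP => E; have [ws [_ + pw]] := reduced_word s.
  by rewrite E => /size0nil ws0; apply: (gen_neq1 Ss); rewrite -pw ws0.
rewrite E add1n; apply/eqP; rewrite eqn_leq hl /=.
have [r [hr <- pr]] := reduced_word (s * w).
rewrite -[w in (len S w <= _)%N](gen_mulK w Ss) -pr -[s * wprod r]/(wprod (s :: r)).
by apply: len_word; apply: is_word_cons.
Qed.

End Words.

(** * Bar-invariant elements of Z[q, q^-1] *)

Section LaurentBar.
Implicit Types p : {poly int}.

Lemma polyL_const (n : int) : polyL n%:P = n%:~R.
Proof. by rewrite -[n in n%:P]intz rmorph_int rmorph_int. Qed.

Lemma polyL_mulX p : polyL ('X * p) = q * polyL p.
Proof. exact: rmorphM. Qed.

Lemma poly_const_shift p : exists p', p = (p`_0)%:P + 'X * p'.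
Proof.
exists (drop_poly 1 p); rewrite -[LHS](poly_take_drop 1) mulrC; congr (_ + _).
by apply/polyP => -[|i]; rewrite coef_take_poly coefC.
Qed.

(** For deg p <= n, q^n p(q^-1) is again a polynomial, with the coefficients of
    p in reverse order. *)
Lemma barL_reverse p n : (size p <= n.+1)%N ->
  barL (polyL p) * q ^+ n = polyL (\poly_(i < n.+1) p`_(n - i)).
Proof.
move=> sp; rewrite (@barLE _ 0 p) ?mulr1 //.
rewrite /evqinv (@horner_coef_wide _ n.+1); last exact: leq_trans (size_poly _ _) _.
rewrite mulr_suml poly_def rmorph_sum /= (reindex_inj rev_ord_inj) /=.
apply: eq_bigr => i _; rewrite coef_map /= subSS.
have le_in : (i <= n)%N by rewrite -ltnS.
rewrite -mul_polyC rmorphM rmorphXn /= polyL_const -mulrA; congr (_ * _).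
rewrite -/q -{3}(subnK le_in) exprD mulrA.
by rewrite -exprMn Defs.mulVq expr1n mul1r.
Qed.

(** An element of q Z[q] fixed by q <-> q^-1 vanishes: if r is such an element,
    of degree n, then q^n r = q^n r(q^-1) has degree at most n, so r is a
    constant. *)
Lemma barL_fixed_mulX p :
  barL (polyL ('X * p)) = polyL ('X * p) -> p = 0.
Proof.
move=> fx; apply/eqP; apply: contraTT isT => p0.
have p'0 : 'X * p != 0 by rewrite mulf_neq0 // polyX_eq0.
set r := 'X * p in fx p'0; pose n := (size r).-1.
have sr : size r = n.+1 by rewrite prednK // lt0n size_poly_eq0.
have := @barL_reverse r n; rewrite sr fx => /(_ (leqnn _)).
rewrite -rmorphXn -rmorphM /= => /polyL_inj E.
have := size_poly n.+1 (fun i => r`_(n - i)); rewrite -E size_mulXn // sr.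
by rewrite -[leqRHS]add0n leq_add2r leqn0 /n /r mulrC size_mulX //=
  size_poly_eq0 (negPf p0).
Qed.

Lemma barL_fixed_const p : barL (polyL p) = polyL p -> p = (p`_0)%:P.
Proof.
have [p' E] := poly_const_shift p; move=> h.
suff p'0 : p' = 0 by rewrite [LHS]E p'0 mulr0 addr0.
apply: barL_fixed_mulX; move: h; rewrite {1 2}E !rmorphD /= polyL_const rmorph_int.
by move/addrI.
Qed.

Lemma barL_fixed_mul_1X2 p :
  barL (polyL ((1 + 'X^2) * p)) = polyL ((1 + 'X^2) * p) -> p = 0.
Proof.
move/barL_fixed_const => E; apply/eqP; apply: contraTT isT => p0.
have s3 : size (1 + 'X^2 : {poly int}) = 3 by rewrite addrC size_polyDl
  ?size_polyXn ?size_poly1.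
have := congr1 (fun r : {poly int} => size r) E.
rewrite size_mul // -?size_poly_eq0 s3 //= => h.
have := size_polyC_leq1 (((1 + 'X^2) * p)`_0); rewrite -h.
by move: p0; rewrite -size_poly_eq0; case: (size p).
Qed.

End LaurentBar.

(** * Coordinates with respect to a basis, lattices and involutions *)

Section Coordinates.
Variables (W : groupType) (I : set W) (H : algType laurent) (M : lmodType H).
Implicit Types (m n : M) (k l : laurent) (A : set W) (f : W -> laurent).

Lemma scaleLBr k m n : scaleL k (m - n) = scaleL k m - scaleL k n.
Proof. exact: scalerBr. Qed.
Lemma scaleLDl k l m : scaleL (k + l) m = scaleL k m + scaleL l m.
Proof. by rewrite /scaleL scalerDl scalerDl. Qed.
Lemma scaleLNl k m : scaleL (- k) m = - scaleL k m.
Proof. by rewrite /scaleL scaleNr scaleNr. Qed.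
Lemma scaleLBl k l m : scaleL (k - l) m = scaleL k m - scaleL l m.
Proof. by rewrite scaleLDl scaleLNl. Qed.
Lemma scaleLA k l m : scaleL k (scaleL l m) = scaleL (k * l) m.
Proof. by rewrite /scaleL scalerA -scalerAl mul1r scalerA. Qed.
Lemma scaleL1 m : scaleL 1 m = m.
Proof. by rewrite /scaleL !scale1r. Qed.
Lemma scaleL0 k : scaleL k (0 : M) = 0.
Proof. exact: scaler0. Qed.
Lemma scale0L m : scaleL 0 m = 0.
Proof. by rewrite /scaleL !scale0r. Qed.
Lemma scaler_scaleL (h : H) k m : h *: scaleL k m = scaleL k (h *: m).
Proof. by rewrite /scaleL !scalerA -scalerAr -scalerAl mulr1 mul1r. Qed.

Lemma scaleL_fsum k A (F : W -> M) : finite_set A ->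
  scaleL k (\sum_(y \in A) F y) = \sum_(y \in A) scaleL k (F y).
Proof. by move=> fA; rewrite !fsbig_finite // /scaleL scaler_sumr. Qed.

Lemma scaler_fsum (h : H) A (F : W -> M) : finite_set A ->
  h *: (\sum_(y \in A) F y) = \sum_(y \in A) h *: F y.
Proof. by move=> fA; rewrite !fsbig_finite // scaler_sumr. Qed.

Lemma fsumD (V : nmodType) A (F G : W -> V) : finite_set A ->
  \sum_(y \in A) (F y + G y) = \sum_(y \in A) F y + \sum_(y \in A) G y.
Proof. by move=> fA; rewrite !fsbig_finite // big_split. Qed.

Lemma fsumB A (F G : W -> M) : finite_set A ->
  \sum_(y \in A) (F y - G y) = \sum_(y \in A) F y - \sum_(y \in A) G y.
Proof. by move=> fA; rewrite !fsbig_finite // sumrB. Qed.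

Lemma fsum_delta A f w : finite_set A ->
  \sum_(y \in A) f y * (w == y)%:R = if w \in A then f w else 0.
Proof.
move=> fA; case: ifPn => [/set_mem Aw|/negP nAw].
  rewrite (fsbigD1 w) //= eqxx mulr1 fsbig1 ?addr0 // => y [_ /eqP ny].
  by rewrite eq_sym (negPf ny) mulr0.
apply: fsbig1 => y Ay; case: eqP => [E|]; last by rewrite mulr0.
by case: nAw; rewrite E; apply/mem_set.
Qed.

Variable c : W -> M.
Hypothesis hc : is_basis I c.

Definition supp f : set W := [set w | I w /\ f w <> 0].

Definition lincomb f : M := \sum_(w \in I) scaleL (f w) (c w).

(** Restricting to a set A containing the support turns [lincomb] into a sum
    that is genuinely finite as soon as A is. *)
Lemma lincombE A f : A `<=` I -> (forall w, I w -> ~ A w -> f w = 0) ->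
  lincomb f = \sum_(w \in A) scaleL (f w) (c w).
Proof.
move=> AI f0; apply/esym/fsbig_widen => // w [Iw nAw] /=.
by rewrite f0 // scale0L.
Qed.

Lemma lincombP k f g : finite_set (supp f) -> finite_set (supp g) ->
  lincomb (fun w => k * f w + g w) = scaleL k (lincomb f) + lincomb g.
Proof.
move=> ff fg; have fU : finite_set (supp f `|` supp g) by rewrite finite_setU.
have sU : supp f `|` supp g `<=` I by move=> w [] [].
have nf w : I w -> ~ (supp f `|` supp g) w -> f w = 0 /\ g w = 0.
  by move=> Iw nU; split; apply: contrapT => n0; apply: nU; [left|right].
have Ef : lincomb f = _ := lincombE sU (fun w Iw nU => (nf w Iw nU).1).
have Eg : lincomb g = _ := lincombE sU (fun w Iw nU => (nf w Iw nU).2).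
rewrite Ef Eg (lincombE sU) => [|w Iw /(nf _ Iw)[-> ->]]; last by rewrite mulr0 addr0.
rewrite scaleL_fsum // !fsbig_finite // -big_split; apply: eq_bigr => w _ /=.
by rewrite scaleLDl scaleLA.
Qed.

(** Setting the coordinates to 0 outside I makes the coordinate lemmas hold at
    every point of W. *)
Definition bcoef m w : laurent :=
  if w \in I then s2val (cid2 (hc.1 m)) w else 0.

Lemma bcoef_supp m : finite_set (supp (bcoef m)).
Proof.
apply: sub_finite_set (s2valP (cid2 (hc.1 m))) => w [Iw] /=.
by rewrite /bcoef ifT ?inE.
Qed.

Lemma lincomb_bcoef m : lincomb (bcoef m) = m.
Proof.
rewrite [RHS](s2valP' (cid2 (hc.1 m))); apply: eq_fsbigr => w Iw.
by rewrite /bcoef ifT.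
Qed.

Lemma bcoef_out m w : ~ I w -> bcoef m w = 0.
Proof. by move=> nI; rewrite /bcoef ifN //; apply/negP => /set_mem. Qed.

Lemma bcoef_uniq f w : finite_set (supp f) -> I w -> bcoef (lincomb f) w = f w.
Proof.
move=> ff Iw; have fc := bcoef_supp (lincomb f).
have := lincombP (-1) fc ff; rewrite lincomb_bcoef scaleLNl scaleL1 addNr => E.
suff F : finite_set (supp (fun w => -1 * bcoef (lincomb f) w + f w)).
  by have /eqP := hc.2 _ F E w Iw; rewrite mulN1r addrC subr_eq0 => /eqP.
apply: (@sub_finite_set _ _ (supp (bcoef (lincomb f)) `|` supp f));
  last by rewrite finite_setU.
move=> v [Iv nv]; apply: contrapT => nU; apply: nv.
suff [-> ->] : bcoef (lincomb f) v = 0 /\ f v = 0 by rewrite mulr0 addr0.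
by split; apply: contrapT => n0; apply: nU; [left|right].
Qed.

Lemma bcoefP k m n w : bcoef (scaleL k m + n) w = k * bcoef m w + bcoef n w.
Proof.
have [Iw|nI] := pselect (I w); last by rewrite !bcoef_out // mulr0 addr0.
rewrite -{1}[m]lincomb_bcoef -{1}[n]lincomb_bcoef -lincombP; try exact: bcoef_supp.
rewrite bcoef_uniq //.
apply: (@sub_finite_set _ _ (supp (bcoef m) `|` supp (bcoef n)));
  last by rewrite finite_setU; split; exact: bcoef_supp.
move=> v [Iv nv]; apply: contrapT => nU; apply: nv.
suff [-> ->] : bcoef m v = 0 /\ bcoef n v = 0 by rewrite mulr0 addr0.
by split; apply: contrapT => n0; apply: nU; [left|right].
Qed.

Lemma bcoefD m n w : bcoef (m + n) w = bcoef m w + bcoef n w.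
Proof. by rewrite -[m in LHS]scaleL1 bcoefP mul1r. Qed.

Lemma bcoef0 w : bcoef 0 w = 0.
Proof. by apply: (@addrI _ (bcoef 0 w)); rewrite -bcoefD !addr0. Qed.

Lemma bcoefZ k m w : bcoef (scaleL k m) w = k * bcoef m w.
Proof. by rewrite -[scaleL k m]addr0 bcoefP bcoef0 addr0. Qed.

Lemma bcoefN m w : bcoef (- m) w = - bcoef m w.
Proof. by rewrite -[m in LHS]scaleL1 -scaleLNl bcoefZ mulN1r. Qed.

Lemma bcoef_fsum A (F : W -> M) w : finite_set A ->
  bcoef (\sum_(y \in A) F y) w = \sum_(y \in A) bcoef (F y) w.
Proof.
move=> fA; rewrite !fsbig_finite //.
exact: (big_morph (bcoef^~ w) (fun m n => bcoefD m n w) (bcoef0 w)).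
Qed.

Lemma bcoef_basis w z : I w -> bcoef (c w) z = (z == w)%:R.
Proof.
move=> Iw; have [Iz|nI] := pselect (I z); last first.
  by rewrite bcoef_out //; case: eqP => // E; case: nI; rewrite E.
have s1 : supp (fun z => (z == w)%:R) `<=` [set w].
  by move=> v [_]; case: eqP.
have E : lincomb (fun z => (z == w)%:R) = c w.
  rewrite (@lincombE [set w]) ?fsbig_set1 ?eqxx ?scaleL1 // => [_ ->//|v _ /eqP].
  by move=> /negPf->.
by rewrite -E bcoef_uniq //; apply: sub_finite_set s1 (finite_set1 w).
Qed.

Lemma bcoef_sum_basis A f w : finite_set A -> A `<=` I ->
  bcoef (\sum_(y \in A) scaleL (f y) (c y)) w = if w \in A then f w else 0.
Proof.
move=> fA AI; rewrite bcoef_fsum // -fsum_delta //.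
by apply: eq_fsbigr => y /set_mem Ay; rewrite bcoefZ (bcoef_basis _ (AI _ Ay)).
Qed.

Lemma bcoef_ext m n : (forall w, bcoef m w = bcoef n w) -> m = n.
Proof.
move=> E; rewrite -[m]lincomb_bcoef -[n]lincomb_bcoef.
by apply: eq_fsbigr => w _; rewrite E.
Qed.

(** The Z[q]-span of the basis, and q times this span. *)
Definition in_lattice m := forall w, exists p, bcoef m w = polyL p.
Definition in_qlattice m := forall w, exists p, bcoef m w = polyL ('X * p).

Lemma in_lattice0 : in_lattice 0.
Proof. by move=> w; exists 0; rewrite bcoef0 rmorph0. Qed.

Lemma in_qlattice0 : in_qlattice 0.
Proof. by move=> w; exists 0; rewrite bcoef0 mulr0 rmorph0. Qed.

Lemma in_latticeD m n : in_lattice m -> in_lattice n -> in_lattice (m + n).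
Proof.
move=> hm hn w; case: (hm w) (hn w) => p Ep [r Er]; exists (p + r).
by rewrite bcoefD Ep Er rmorphD.
Qed.

Lemma in_qlatticeD m n : in_qlattice m -> in_qlattice n -> in_qlattice (m + n).
Proof.
move=> hm hn w; case: (hm w) (hn w) => p Ep [r Er]; exists (p + r).
by rewrite bcoefD Ep Er mulrDr rmorphD.
Qed.

Lemma in_qlatticeN m : in_qlattice m -> in_qlattice (- m).
Proof.
by move=> hm w; case: (hm w) => p Ep; exists (- p); rewrite bcoefN Ep mulrN rmorphN.
Qed.

Lemma in_latticeZ p m : in_lattice m -> in_lattice (scaleL (polyL p) m).
Proof.
by move=> hm w; case: (hm w) => r Er; exists (p * r); rewrite bcoefZ Er rmorphM.
Qed.

Lemma in_qlatticeZ p m :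
  in_lattice m -> in_qlattice (scaleL (polyL ('X * p)) m).
Proof.
move=> hm w; case: (hm w) => r Er; exists (p * r).
by rewrite bcoefZ Er mulrA [RHS]rmorphM.
Qed.

Lemma in_lattice_sum A (F : W -> M) :
  finite_set A -> (forall y, A y -> in_lattice (F y)) ->
  in_lattice (\sum_(y \in A) F y).
Proof.
move=> fA hF; rewrite fsbig_finite // big_seq.
elim/big_ind: _ => [||y]; [exact: in_lattice0|exact: in_latticeD|].
by rewrite in_fset_set // => /set_mem /hF.
Qed.

Lemma in_qlattice_sum A (F : W -> M) :
  finite_set A -> (forall y, A y -> in_qlattice (F y)) ->
  in_qlattice (\sum_(y \in A) F y).
Proof.
move=> fA hF; rewrite fsbig_finite // big_seq.
elim/big_ind: _ => [||y]; [exact: in_qlattice0|exact: in_qlatticeD|].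
by rewrite in_fset_set // => /set_mem /hF.
Qed.

Lemma in_lattice_basis w : I w -> in_lattice (c w).
Proof. by move=> Iw z; exists (z == w)%:R; rewrite bcoef_basis // rmorph_nat. Qed.

Variable barM : M -> M.
Hypothesis barMD : forall m n, barM (m + n) = barM m + barM n.
Hypothesis barMZ : forall k m, barM (scaleL k m) = scaleL (barL k) (barM m).
Hypothesis barMc : forall w, I w -> barM (c w) = c w.

Lemma barM0 : barM 0 = 0.
Proof. by rewrite -(scale0L 0) barMZ rmorph0 !scale0L. Qed.

Lemma barMB m n : barM (m - n) = barM m - barM n.
Proof. by rewrite barMD -[in LHS](scaleL1 n) -scaleLNl barMZ rmorphN1 scaleLNl
  scaleL1. Qed.

Lemma barM_fsum A (F : W -> M) : finite_set A ->
  barM (\sum_(y \in A) F y) = \sum_(y \in A) barM (F y).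
Proof.
by move=> fA; rewrite !fsbig_finite //; exact: (big_morph barM barMD barM0).
Qed.

(** A semilinear map fixing the basis acts on coordinates by q <-> q^-1. *)
Lemma bcoef_bar m w : bcoef (barM m) w = barL (bcoef m w).
Proof.
have [Iw|nI] := pselect (I w); last by rewrite !bcoef_out // rmorph0.
have fm := bcoef_supp m.
have s : supp (bcoef m) `<=` I by move=> v [].
have s0 f : (forall v, bcoef m v = 0 -> f v = 0) ->
    lincomb f = \sum_(y \in supp (bcoef m)) scaleL (f y) (c y).
  move=> hf; apply: lincombE => // v Iv nv; apply: hf.
  by apply: contrapT => nz; apply: nv.
rewrite -[m in LHS]lincomb_bcoef s0 // barM_fsum //.
rewrite (eq_fsbigr (fun y => scaleL (barL (bcoef m y)) (c y))); last first.
  by move=> y /set_mem[Iy _]; rewrite barMZ barMc.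
rewrite -s0 => [|v ->]; last by rewrite rmorph0.
rewrite bcoef_uniq //; apply: sub_finite_set fm => v [Iv nv]; split=> // E.
by apply: nv; rewrite E rmorph0.
Qed.

Lemma bar_qlattice_eq0 m : barM m = m -> in_qlattice m -> m = 0.
Proof.
move=> bm qm; apply: bcoef_ext => w; have [p E] := qm w.
have := bcoef_bar m w; rewrite bm bcoef0 E => /esym/barL_fixed_mulX ->.
by rewrite mulr0 rmorph0.
Qed.

End Coordinates.

(** * The action of the Hecke generators on the canonical basis *)

Section WGraph.
Variables (W : groupType) (S : set W).
Variables (H : algType laurent) (T : W -> H) (barH : {rmorphism H -> H}).
Variables (I J : set W) (M : lmodType H) (b : W -> M) (barM : M -> M).
Variables (c : W -> M) (Q : W -> W -> {poly int}).
Hypotheses (hW : coxeter_system S) (hH : is_hecke_algebra S T).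
Hypotheses (hbar : is_hecke_bar S T barH).
Hypotheses (hI : W_graph_ideal S I J T barH b barM).
Hypothesis (hc : canonical_basis S I b barM c Q).
Implicit Types (s u v w x y z : W) (m n : M).

Let hcb : is_basis I c := cb_basis hc.
Local Notation coefc := (bcoef hcb).
Let barMD := wgi_barD hI.
Let barMZ := wgi_barZ hI.
Let barMc := cb_bar hc.

Lemma ascent_or_descent w s : S s -> I w -> AJ S I J w s \/ DJ S J w s.
Proof.
move=> Ss Iw; case: (bruhat_gen_total hW w Ss) => hs; first by right; left.
have [Isw|nI] := pselect (I (s * w)%g); first by left; left.
by have [Dsw|nD] := pselect (D_set S J (s * w)%g); [left; right|right; right].
Qed.

Lemma ascent_lt w s : AJ S I J w s -> bruhat_lt S w (s * w)%g.
Proof. by case=> -[_ []]. Qed.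

Lemma ascent_descentF w s : AJ S I J w s -> ~ DJ S J w s.
Proof.
move=> hA [[_ hD]|[_ [_ nD]]].
  exact: (bruhat_lt_asym hW (ascent_lt hA)).
by case: hA => -[_ [_ h]]; apply: nD; [exact: (wgi_D hI)|case: h].
Qed.

Lemma descent_down w s : I w -> SD S w s -> I (s * w)%g /\ SA S I (s * w)%g s.
Proof.
move=> Iw [Ss hs]; have Isw := wgi_ideal hI Iw (gen_suffix hW Ss hs).
by split=> //; split=> //; rewrite (gen_mulK hW).
Qed.

Definition lower w : set W := [set y | I y /\ bruhat_lt S y w].

Lemma lower_finite w : finite_set (lower w).
Proof. by apply: sub_finite_set (bruhat_lt_finite hW w) => y []. Qed.

Lemma lower_sub w : lower w `<=` I.
Proof. by move=> y []. Qed.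

Hint Resolve lower_finite lower_sub : core.

Lemma lowerNself w : ~ lower w w.
Proof. by case=> _ []. Qed.

Lemma lower_len w y : lower w y -> (len S y < len S w)%N.
Proof. by case=> _ /(bruhat_lt_len hW). Qed.

Lemma Q_out y w : ~ lower w y -> Q y w = 0.
Proof. by move=> nL; apply: (cb_out hc) => -[Iy _ yw]; apply: nL. Qed.

Lemma basis_dec w : I w -> b w =
  c w + \sum_(y \in lower w) scaleL (polyL ('X * Q y w)) (c y).
Proof.
move=> Iw; rewrite (cb_dec hc Iw) scaleL_fsum; last exact: lower_finite.
by congr (_ + _); apply: eq_fsbigr => y _; rewrite scaleLA [in RHS]rmorphM.
Qed.

Lemma coef_dec w z : I w -> I z ->
  coefc (b w) z = (z == w)%:R + q * polyL (Q z w).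
Proof.
move=> Iw Iz; rewrite basis_dec // bcoefD bcoef_basis // bcoef_sum_basis //.
rewrite polyL_mulX; case: ifPn => // /negP nz.
by rewrite (Q_out (fun h => nz (mem_set h))) rmorph0 mulr0.
Qed.

Lemma dec_lattice w : I w -> in_lattice hcb (b w).
Proof.
move=> Iw; rewrite basis_dec //; apply: in_latticeD; first exact: in_lattice_basis.
apply: in_lattice_sum => // y Ly; apply: in_latticeZ; apply: in_lattice_basis.
exact: lower_sub Ly.
Qed.

Lemma dec_qlattice w : I w -> in_qlattice hcb (b w - c w).
Proof.
move=> Iw; rewrite basis_dec // addrC addKr.
apply: in_qlattice_sum => // y Ly; apply: in_qlatticeZ; apply: in_lattice_basis.
exact: lower_sub Ly.
Qed.

Lemma hecke_quadratic s m : S s ->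
  T s *: (T s *: m) = m + scaleL (q - qinv) (T s *: m).
Proof.
move=> Ss; rewrite scalerA (hH.1.1 _ Ss) scalerDl scale1r; congr (_ + _).
by rewrite /scaleL scalerA -scalerAl mul1r.
Qed.

Lemma barM_T s m : S s ->
  barM (T s *: m) = T s *: barM m - scaleL (q - qinv) (barM m).
Proof.
by move=> Ss; rewrite (wgi_barH hI); case: hbar => _ _ /(_ _ Ss) ->; rewrite scalerBl.
Qed.

(** Cutting mu_{y,w} off unless s is a descent of y lets the sum in the W-graph
    formula run over all of [lower w]. *)
Definition mu_desc s y w : int := if `[< DJ S J y s >] then mu Q y w else 0.

(** The term c_{sw}, which is only present for strong ascents. *)
Definition up_term s w : M := if `[< SA S I w s >] then c (s * w)%g else 0.

(** The two rules of a W-graph, with strong and weak ascents treated alike. *)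
Definition wgraph_action w : Prop := forall s, S s ->
  (DJ S J w s -> T s *: c w = scaleL (- qinv) (c w)) /\
  (AJ S I J w s -> T s *: c w = scaleL q (c w) + up_term s w +
     \sum_(y \in lower w) scaleL (mu_desc s y w)%:~R (c y)).

Lemma up_term_bar s w : barM (up_term s w) = up_term s w.
Proof.
rewrite /up_term; case: asboolP => [[_ [_ Isw]]|_]; first exact: barMc.
exact: barM0 barMZ.
Qed.

Lemma up_term_lattice s w : in_lattice hcb (up_term s w).
Proof.
rewrite /up_term; case: asboolP => [[_ [_ Isw]]|_]; first exact: in_lattice_basis.
exact: in_lattice0.
Qed.

Lemma mu_desc_sum_bar s w :
  barM (\sum_(y \in lower w) scaleL (mu_desc s y w)%:~R (c y)) =
  \sum_(y \in lower w) scaleL (mu_desc s y w)%:~R (c y).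
Proof.
rewrite (barM_fsum barMD barMZ) //; apply: eq_fsbigr => y /set_mem[Iy _].
by rewrite barMZ barMc // rmorph_int.
Qed.

Lemma mu_desc_sum_lattice s w :
  in_lattice hcb (\sum_(y \in lower w) scaleL (mu_desc s y w)%:~R (c y)).
Proof.
apply: in_lattice_sum => // y [Iy _]; rewrite -polyL_const.
by apply: in_latticeZ; exact: in_lattice_basis.
Qed.

Lemma coef_up_term s w y : coefc (up_term s w) y =
  (`[< SA S I w s >] && (y == s * w)%g)%:R.
Proof.
rewrite /up_term; case: asboolP => [[_ [_ Isw]]|_]; last exact: bcoef0.
exact: bcoef_basis.
Qed.

(** Apart from c_w itself, every c_z occurring in T_s c_w has s as a descent:
    this holds for z = sw and by the definition of [mu_desc]. *)
Lemma coef_action_ascent w s z : S s -> I w -> wgraph_action w ->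
  AJ S I J z s -> coefc (T s *: c w) z = q * (z == w)%:R.
Proof.
move=> Ss Iw hw Az; case: (ascent_or_descent Ss Iw) => hs.
  rewrite ((hw s Ss).2 hs) !bcoefD bcoefZ bcoef_basis // coef_up_term.
  rewrite bcoef_sum_basis // /mu_desc.
  have -> : `[< DJ S J z s >] = false by apply/asboolP; exact: ascent_descentF.
  rewrite if_same addr0; case: asboolP => [[_ [lt _]]|_]; rewrite ?addr0 //.
  case: (z =P (s * w)%g) => [E|_]; rewrite ?addr0 //; exfalso.
  have := ascent_lt Az; rewrite E (gen_mulK hW) //.
  exact: (bruhat_lt_asym hW).
rewrite ((hw s Ss).1 hs) bcoefZ bcoef_basis //; case: eqP => [E|_];
  last by rewrite !mulr0.
by case: (ascent_descentF Az); rewrite E.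
Qed.

Lemma coef_action_descent w s z : S s -> I w -> I z -> wgraph_action w ->
  DJ S J z s -> coefc (T s *: c w) z =
    - qinv * (z == w)%:R + (`[< SA S I w s >] && (z == s * w)%g)%:R +
    (if `[< lower w z /\ ~ DJ S J w s >] then (mu Q z w)%:~R else 0).
Proof.
move=> Ss Iw Iz hw Dz; case: (ascent_or_descent Ss Iw) => hs.
  rewrite ((hw s Ss).2 hs) !bcoefD bcoefZ bcoef_basis // coef_up_term.
  rewrite bcoef_sum_basis // /mu_desc.
  have -> : `[< DJ S J z s >] = true by apply/asboolP.
  have -> : (z \in lower w) = `[< lower w z /\ ~ DJ S J w s >].
    by apply/idP/asboolP => [/set_mem Lz|[/mem_set]] //; split=> //;
      exact: ascent_descentF.
  have -> : (z == w) = false.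
    by apply/eqP => E; case: (ascent_descentF hs); rewrite -E.
  by rewrite !mulr0.
rewrite ((hw s Ss).1 hs) bcoefZ bcoef_basis //.
have -> : `[< SA S I w s >] = false.
  by apply/asboolP => hA; apply: (ascent_descentF (or_introl hA : AJ S I J w s)).
have -> : `[< lower w z /\ ~ DJ S J w s >] = false by apply/asboolP => -[].
by rewrite !addr0.
Qed.

(** For a strong ascent this is b_{sw} - c_{sw} - q b_w; for a weak one it is
    minus the sum with coefficients in q Z[q] from the definition. *)
Lemma ascent_dec_qlattice w s : S s -> I w -> AJ S I J w s ->
  in_qlattice hcb (T s *: b w - scaleL q (b w) - up_term s w).
Proof.
move=> Ss Iw hA.
have Zq m : in_lattice hcb m -> in_qlattice hcb (scaleL q m).
  by move=> /(in_qlatticeZ 1); rewrite mulr1.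
rewrite /up_term; case: asboolP => [SAw|nSA].
  have Isw : I (s * w)%g by case: SAw => _ [].
  rewrite (wgi_SA hI Iw SAw) addrAC; apply: in_qlatticeD; first exact: dec_qlattice.
  by apply: in_qlatticeN; apply: Zq; exact: dec_lattice.
case: hA => // WAw; have [r rX ->] := wgi_WA hI Iw WAw.
rewrite subr0 addrAC subrr add0r; apply: in_qlatticeN.
apply: in_qlattice_sum => [|y [Iy _]]; first exact: lower_finite.
by have [p ->] := rX y; apply: in_qlatticeZ; exact: dec_lattice.
Qed.

(** When s is a descent of y, T_s - q multiplies c_y by - q - q^-1, and
    q q_{y,w} (- q - q^-1) = - q_{y,w} - q^2 q_{y,w}: adding mu_{y,w} removes
    the constant term. *)
Lemma ascent_lower_qlattice w s y : S s -> I y -> wgraph_action y ->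
  in_qlattice hcb (scaleL (polyL ('X * Q y w)) (T s *: c y - scaleL q (c y))
                   + scaleL (mu_desc s y w)%:~R (c y)).
Proof.
move=> Ss Iy hy; rewrite /mu_desc; case: asboolP => hs.
  rewrite ((hy s Ss).1 hs) -scaleLBl scaleLA -scaleLDl.
  have [p Ep] := poly_const_shift (Q y w).
  suff -> : polyL ('X * Q y w) * (- qinv - q) + (mu Q y w)%:~R =
      polyL ('X * (- p - 'X * Q y w)).
    by apply: in_qlatticeZ; exact: in_lattice_basis.
  rewrite !polyL_mulX rmorphB rmorphN /= polyL_mulX -[(mu Q y w)%:~R]polyL_const /mu.
  rewrite mulrBr mulrN [q * _ * qinv]mulrAC mulqV mul1r {1}Ep rmorphD /= polyL_mulX.
  rewrite mulrBr mulrN opprD addrAC [- polyL _ - _ + _]addrAC addNr add0r.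
  by rewrite -mulrA [polyL _ * q]mulrC.
rewrite scale0L addr0; apply: in_qlatticeZ.
have hA : AJ S I J y s by case: (ascent_or_descent Ss Iy).
rewrite ((hy s Ss).2 hA) -[X in X - _]addrA addrAC subrr add0r.
by apply: in_latticeD; [exact: up_term_lattice|exact: mu_desc_sum_lattice].
Qed.

(** The difference of the two sides is bar-invariant; substituting
    c_w = b_w - sum_y q q_{y,w} c_y shows that it lies in q times the lattice. *)
Lemma action_ascent w s : S s -> I w ->
  (forall y, lower w y -> wgraph_action y) ->
  AJ S I J w s -> T s *: c w = scaleL q (c w) + up_term s w +
     \sum_(y \in lower w) scaleL (mu_desc s y w)%:~R (c y).
Proof.
move=> Ss Iw IH hA; set mus := (X in _ = _ + X).
suff /eqP : (T s *: c w - scaleL q (c w)) - (up_term s w + mus) = 0.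
  by rewrite subr_eq0 subr_eq => /eqP ->; rewrite addrC addrA.
apply: (bar_qlattice_eq0 barMD barMZ barMc).
  rewrite !(barMB barMD barMZ) barMD up_term_bar mu_desc_sum_bar barM_T //
    barMZ barMc // barL_q.
  by rewrite scaleLBl [- (_ - scaleL qinv _)]opprD opprK addrA addrK.
have -> : c w = b w - \sum_(y \in lower w) scaleL (polyL ('X * Q y w)) (c y).
  by rewrite [in RHS]basis_dec // addrK.
set B := (X in b w - X).
have -> : T s *: (b w - B) - scaleL q (b w - B) - (up_term s w + mus) =
    (T s *: b w - scaleL q (b w) - up_term s w) - ((T s *: B - scaleL q B) + mus).
  rewrite scalerBr scaleLBr !opprD !opprK !addrA; congr (_ - _).
  rewrite [LHS]addrAC; congr (_ + _); rewrite -!addrA; congr (_ + _).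
  by rewrite addrC -addrA.
apply: in_qlatticeD; first exact: ascent_dec_qlattice.
apply: in_qlatticeN; rewrite /B /mus scaler_fsum // scaleL_fsum // -fsumB // -fsumD //.
apply: in_qlattice_sum => // y Ly.
rewrite scaler_scaleL scaleLA [q * _]mulrC -scaleLA -scaleLBr.
by apply: ascent_lower_qlattice => //; [exact: lower_sub Ly|exact: IH].
Qed.

(** As no c_y with y <> z contributes to c_z in (T_s + q^-1) b_w = 0, the
    coefficient of c_z in (T_s + q^-1) c_w is - q q_{z,w} (q + q^-1). *)
Lemma descent_Q0 w s : S s -> I w -> (forall y, lower w y -> wgraph_action y) ->
  T s *: b w = scaleL (- qinv) (b w) ->
  forall z, I z -> AJ S I J z s -> z <> w -> Q z w = 0.
Proof.
move=> Ss Iw IH hb z Iz Az nzw; apply: barL_fixed_mul_1X2.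
pose d := T s *: c w + scaleL qinv (c w).
have bd : barM d = d.
  rewrite /d barMD barM_T // barMZ barMc // barL_qinv scaleLBl opprB addrA.
  by rewrite subrK addrC.
have : bcoef hcb (T s *: b w + scaleL qinv (b w)) z = 0.
  by rewrite hb scaleLNl addNr bcoef0.
rewrite {1}basis_dec // scalerDr bcoefD bcoefZ coef_dec // bcoefD.
rewrite scaler_fsum // bcoef_fsum //.
rewrite (eq_fsbigr (fun y => q * polyL ('X * Q y w) * (z == y)%:R)); last first.
  move=> y /set_mem Ly; rewrite scaler_scaleL bcoefZ.
  rewrite (coef_action_ascent Ss (lower_sub Ly) (IH _ Ly) Az).
  by rewrite mulrA [polyL _ * q]mulrC.
rewrite fsum_delta //.
have -> : (z == w) = false by apply/eqP.
rewrite add0r.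
have -> : (if z \in lower w then q * polyL ('X * Q z w) else 0) =
    q * polyL ('X * Q z w).
  by case: ifPn => // /negP nz; rewrite (Q_out (fun h => nz (mem_set h))) mulr0
    rmorph0 mulr0.
have Ed : bcoef hcb d z = bcoef hcb (T s *: c w) z.
  rewrite /d bcoefD bcoefZ bcoef_basis //.
  have -> : (z == w) = false by apply/eqP.
  by rewrite mulr0 addr0.
rewrite -Ed mulrA Defs.mulVq mul1r -addrA => /eqP; rewrite addr_eq0 => /eqP E.
have := bcoef_bar hcb barMD barMZ barMc d z; rewrite bd E.
have -> : q * polyL ('X * Q z w) + polyL (Q z w) = polyL ((1 + 'X^2) * Q z w).
  by rewrite mulrDl mul1r rmorphD addrC expr2 -mulrA /= !polyL_mulX.
by rewrite rmorphN => /oppr_inj/esym.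
Qed.

(** By [descent_Q0], every c_y other than c_w occurring in b_w is an
    eigenvector for - q^-1; so is b_w, hence c_w. *)
Lemma action_weak_descent w s : S s -> I w ->
  (forall y, lower w y -> wgraph_action y) ->
  WD S J w s -> T s *: c w = scaleL (- qinv) (c w).
Proof.
move=> Ss Iw IH hD; have hb := wgi_WD hI Iw hD.
have Q0 := descent_Q0 Ss Iw IH hb.
have -> : c w = b w - \sum_(y \in lower w) scaleL (polyL ('X * Q y w)) (c y).
  by rewrite [in RHS]basis_dec // addrK.
rewrite scalerBr scaleLBr hb scaler_fsum // scaleL_fsum //; congr (_ - _).
apply: eq_fsbigr => y /set_mem Ly; have Iy := lower_sub Ly.
case: (ascent_or_descent Ss Iy) => hs.
  rewrite Q0 //; first by rewrite mulr0 rmorph0 !scale0L scaler0 scaleL0.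
  by move=> E; move: Ly; rewrite E; exact: lowerNself.
by rewrite scaler_scaleL ((IH _ Ly s Ss).1 hs) !scaleLA mulrC.
Qed.

(** Here c_w = (T_s - q) c_{sw} - sum_y mu_{y,sw} c_y over certain y < sw with
    s as a descent, and T_s + q^-1 kills every term. *)
Lemma action_strong_descent w s : S s -> I w ->
  (forall y, I y -> (len S y < len S w)%N -> wgraph_action y) ->
  SD S w s -> T s *: c w = scaleL (- qinv) (c w).
Proof.
move=> Ss Iw IH hD; have [Iv SAv] := descent_down Iw hD.
have lv := bruhat_lt_len hW hD.2; pose v := (s * w)%g.
have := (IH v Iv lv s Ss).2 (or_introl SAv).
rewrite /up_term; case: asboolP => // _; rewrite (gen_mulK hW) // => E.
set mus := (X in _ = _ + X) in E.
have Ew : c w = T s *: c v - scaleL q (c v) - mus by rewrite E addrAC addrK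
  addrAC subrr add0r.
have Emus : T s *: mus = scaleL (- qinv) mus.
  rewrite /mus scaler_fsum // scaleL_fsum //; apply: eq_fsbigr => y /set_mem Ly.
  have Iy := lower_sub Ly; rewrite /mu_desc; case: asboolP => hs; last first.
    by rewrite !scale0L scaler0 scaleL0.
  have ly : (len S y < len S w)%N by apply: ltn_trans lv; exact: lower_len.
  by rewrite scaler_scaleL ((IH _ Iy ly s Ss).1 hs) !scaleLA mulrC.
rewrite Ew scalerBr scaleLBr Emus; congr (_ - _).
rewrite scalerBr scaler_scaleL hecke_quadratic // scaleLBr !scaleLNl scaleLA
  Defs.mulVq scaleL1.
by rewrite scaleLBl opprK addrA addrAC addrK addrC.
Qed.

Lemma wgraph_actionP w : I w -> wgraph_action w.
Proof.
have [n] := ubnP (len S w); elim: n w => // n IH w; rewrite ltnS => hn Iw s Ss.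
have IHlen y : I y -> (len S y < len S w)%N -> wgraph_action y.
  by move=> Iy ly; apply: IH => //; exact: leq_trans hn.
have IHlow y : lower w y -> wgraph_action y.
  by move=> Ly; apply: IHlen; [exact: lower_sub Ly|exact: lower_len].
split; last exact: action_ascent.
case=> hD; [exact: action_strong_descent|exact: action_weak_descent].
Qed.

(** * Recursion for the polynomials q_{y,w} *)

Lemma Q_out_if w x (k : laurent) :
  (if x \in lower w then polyL (Q x w) * k else 0) = polyL (Q x w) * k.
Proof.
case: ifPn => // /negP nL.
by rewrite (Q_out (fun h => nL (mem_set h))) rmorph0 mul0r.
Qed.

(** The coefficient of c_z in T_s b_w = b_{sw}, divided by q. *)
Lemma Q_rec_coef w s z : S s -> I w -> I z -> SA S I w s -> z <> (s * w)%g ->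
  polyL (Q z (s * w)%g) = qinv * bcoef hcb (T s *: c w) z +
    \sum_(x \in lower w) polyL (Q x w) * bcoef hcb (T s *: c x) z.
Proof.
move=> Ss Iw Iz SAw nz; have Isw : I (s * w)%g by case: SAw => _ [].
have := coef_dec Isw Iz.
rewrite -(wgi_SA hI Iw SAw) basis_dec // scalerDr bcoefD scaler_fsum // bcoef_fsum //.
have -> : (z == s * w)%g = false by apply/eqP.
rewrite add0r => /(congr1 ( *%R qinv)); rewrite mulrA Defs.mulVq mul1r => <-.
rewrite mulrDr !fsbig_finite // mulr_sumr; congr (_ + _); apply: eq_bigr => x _.
by rewrite scaler_scaleL bcoefZ polyL_mulX !mulrA Defs.mulVq mul1r.
Qed.

Lemma Q_rec_ascent w s z : S s -> I w -> I z -> SA S I w s -> z <> (s * w)%g ->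
  AJ S I J z s -> polyL (Q z (s * w)%g) = (z == w)%:R + q * polyL (Q z w).
Proof.
move=> Ss Iw Iz SAw nz Az; rewrite Q_rec_coef //.
rewrite (coef_action_ascent Ss Iw (wgraph_actionP Iw) Az) mulrA Defs.mulVq mul1r.
rewrite (eq_fsbigr (fun x => polyL (Q x w) * q * (z == x)%:R)); last first.
  move=> x /set_mem Lx; have Ix := lower_sub Lx.
  by rewrite (coef_action_ascent Ss Ix (wgraph_actionP Ix) Az) mulrA.
by rewrite fsum_delta // Q_out_if mulrC.
Qed.

Lemma mu_out y w : ~ lower w y -> mu Q y w = 0.
Proof. by move=> /Q_out; rewrite /mu => ->; rewrite coef0. Qed.

(** The three ways in which c_z occurs in some T_s c_x give the three terms:
    x = z (eigenvalue - q^-1), z = sx, and z < x through mu_{z,x}; the term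
    q^-1 mu_{z,w} comes from x = w. *)
Lemma Q_rec_descent w s z : S s -> I w -> I z -> SA S I w s -> z <> (s * w)%g ->
  DJ S J z s -> polyL (Q z (s * w)%g) =
    - qinv * (polyL (Q z w) - (mu Q z w)%:~R)
    + (if `[< SD S z s >] then polyL (Q (s * z)%g w) else 0)
    + \sum_(x \in [set x | [/\ I x, bruhat_lt S z x, bruhat_lt S x w
                                     & ~ DJ S J x s]])
                (mu Q z x)%:~R * polyL (Q x w).
Proof.
move=> Ss Iw Iz SAw nz Dz; rewrite Q_rec_coef //.
have Aw : AJ S I J w s by left.
rewrite (coef_action_descent Ss Iw Iz (wgraph_actionP Iw) Dz).
have -> : (z == w) = false.
  by apply/eqP => E; case: (ascent_descentF Aw); rewrite -E.
have -> : (z == s * w)%g = false by apply/eqP.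
rewrite andbF mulr0 !add0r.
have -> : (if `[< lower w z /\ ~ DJ S J w s >] then (mu Q z w)%:~R else 0) =
    (mu Q z w)%:~R :> laurent.
  case: asboolP => // nL; rewrite mu_out // => Lz; apply: nL; split=> //.
  exact: ascent_descentF.
(* the contributions of x = z, of x = sz and of mu_{z,x} *)
pose f1 x := polyL (Q x w) * - qinv * (z == x)%:R.
pose f2 x := polyL (Q x w) * `[< SD S z s >]%:R * (s * z == x)%g%:R.
pose f3 x := if x \in [set x | lower x z /\ ~ DJ S J x s]
  then (mu Q z x)%:~R * polyL (Q x w) else 0.
rewrite (eq_fsbigr (fun x => f1 x + f2 x + f3 x)); last first.
  move=> x /set_mem Lx; have Ix := lower_sub Lx.
  rewrite (coef_action_descent Ss Ix Iz (wgraph_actionP Ix) Dz) 2!mulrDr mulrA.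
  congr (_ + _ + _); last first.
    have -> : `[< lower x z /\ ~ DJ S J x s >] =
        (x \in [set x | lower x z /\ ~ DJ S J x s]).
      by apply/asboolP/idP => [/mem_set|/set_mem].
    by rewrite /f3; case: ifP => _; rewrite ?mulr0 // mulrC.
  rewrite /f2 -mulrA -natrM mulnb; congr (_ * _%:R); congr nat_of_bool.
  apply/andP/andP => -[/asboolP h /eqP E]; split.
  - by apply/asboolP; rewrite E /SD /= (gen_mulK hW) //; case: h => _ [].
  - by rewrite E (gen_mulK hW).
  - by apply/asboolP; rewrite -E; case: (descent_down Iz h).
  - by rewrite -E (gen_mulK hW).
have fL := lower_finite w.
rewrite (fsumD _ _ fL) (fsumD _ _ fL).
rewrite {}/f1 {}/f2 (fsum_delta _ _ fL).
rewrite (fsum_delta _ _ fL).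
rewrite !Q_out_if {}/f3 -fsbig_mkcondr !addrA.
congr (_ + _ + _).
- by rewrite mulrBr !mulNr mulrN opprK addrC [_ * qinv]mulrC.
- by case: asboolP => _; rewrite ?mulr1 ?mulr0.
apply: eq_fsbigl; apply/seteqP; split=> x /=.
  by move=> [[Ix xw] [[_ zx] nD]].
by move=> [Ix zx xw nD].
Qed.

End WGraph.

Unset Implicit Arguments.

Theorem corollary7p4 (W : groupType) (S : set W)
  (H : algType laurent) (T : W -> H) (barH : {rmorphism H -> H})
  (I J : set W) (M : lmodType H) (b : W -> M) (barM : M -> M)
  (c : W -> M) (Q : W -> W -> {poly int})
  (hW : coxeter_system S)
  (hH : is_hecke_algebra S T)
  (hbar : is_hecke_bar S T barH)
  (hI : W_graph_ideal S I J T barH b barM)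
  (hc : canonical_basis S I b barM c Q)
  (s w y : W) (hs : S s) (hw : I w) (hy : I y)
  (hwsw : bruhat_lt S w (s * w)%g) (hsw : I (s * w)%g)
  (hysw : bruhat_lt S y (s * w)%g) :
  (y = w -> Q y (s * w)%g = 1) /\
  (y <> w ->
    [/\ AJ S I J y s ->
          polyL (Q y (s * w)%g) = q * polyL (Q y w),
        SD S y s ->
          polyL (Q y (s * w)%g) =
            - qinv * (polyL (Q y w) - (mu Q y w)%:~R) + polyL (Q (s * y)%g w)
            + \sum_(x \in [set x | [/\ I x, bruhat_lt S y x, bruhat_lt S x w
                                     & ~ DJ S J x s]])
                (mu Q y x)%:~R * polyL (Q x w)
      & WD S J y s ->
          polyL (Q y (s * w)%g) =
            - qinv * (polyL (Q y w) - (mu Q y w)%:~R)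
            + \sum_(x \in [set x | [/\ I x, bruhat_lt S y x, bruhat_lt S x w
                                     & ~ DJ S J x s]])
                (mu Q y x)%:~R * polyL (Q x w)]).
Proof.
have SAw : SA S I w s by [].
have nysw : y <> (s * w)%g by case: hysw.
have rec_ascent := Q_rec_ascent hW hH hbar hI hc hs hw hy SAw nysw.
have rec_descent := Q_rec_descent hW hH hbar hI hc hs hw hy SAw nysw.
split=> [yw|nyw].
  apply: polyL_inj; rewrite rec_ascent; last by rewrite yw; left.
  rewrite yw eqxx (cb_out hc) ?rmorph0 ?mulr0 ?addr0 ?rmorph1 //.
  by case=> _ _ [].
split=> hsy.
- by rewrite rec_ascent //; case: eqP nyw => // _ _; rewrite add0r.
- by rewrite rec_descent; [case: asboolP|left].
rewrite rec_descent; last by right.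
case: asboolP => [hD|_]; last by rewrite addr0.
by case: (bruhat_lt_asym hW hD.2 hsy.2.1).
Qed.
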